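(* Let $\Omega \subset \mathbb{R}^q$ be a bounded domain with volume $|\Omega| > 0$, let $\omega : \Omega \to [0,\infty)$ be integrable, and let $d \in \mathbb{N}_0$. Let $(\mathbf{x}_n)_{n \in \mathbb{N}}$ be a sequence of distinct points in $\Omega$. Let $N_0 \in \mathbb{N}_0$ be such that $X_{N_0} = \{\mathbf{x}_n\}_{n=1}^{N_0} \subset \Omega$ is $\mathbb{P}_d(\mathbb{R}^q)$-unisolvent and $\omega(\mathbf{x}_n) > 0$ for $n = 1,\dots,N_0$. Moreover, for $N > N_0$, let $X_N = X_{N_0} \cup \{\mathbf{x}_n\}_{n=N_0+1}^{N}$ and $r_n = \omega(\mathbf{x}_n)|\Omega|/N$ for $n=1,\dots,N$. Assume that $$\lim_{N \to \infty} \frac{|\Omega|}{N} \sum_{n=1}^N u(\mathbf{x}_n) v(\mathbf{x}_n) \omega(\mathbf{x}_n) = \int_\Omega u(\boldsymbol{x}) v(\boldsymbol{x}) \omega(\boldsymbol{x}) \, \mathrm{d}\boldsymbol{x} \quad \text{for all } u,v \in \mathbb{P}_d(\mathbb{R}^q).$$ Then there exists an $N_1 \in \mathbb{N}_0$ such that for all $N \geq N_1$ the following statements hold: (a) The LS-CF with degree of exactness $d$ on $X_N$, with cubature weights $\mathbf{w}^{\mathrm{LS}} \in \mathbb{R}^N$, is nonnegative. (b) The $\ell^1$-CF with degree of exactness $d$ on $X_N$, with cubature weights $\mathbf{w}^{\ell^1} \in \mathbb{R}^N$, is nonnegative.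
   Context: $\mathbb{P}_d(\mathbb{R}^q)$ is the vector space of real polynomials in $q$ variables of total degree at most $d$, and $K = \dim \mathbb{P}_d(\mathbb{R}^q) = \binom{d+q}{q}$. A set of points $X = \{\mathbf{x}_n\}_{n=1}^N \subset \mathbb{R}^q$ is called $\mathbb{P}_d(\mathbb{R}^q)$-unisolvent if the only $p \in \mathbb{P}_d(\mathbb{R}^q)$ with $p(\mathbf{x}_n) = 0$ for $n=1,\dots,N$ is $p \equiv 0$. Let $I[f] = \int_\Omega f(\boldsymbol{x})\omega(\boldsymbol{x})\,\mathrm{d}\boldsymbol{x}$. Let $\{p_k\}_{k=1}^K$ be a basis of $\mathbb{P}_d(\mathbb{R}^q)$, let $P = (p_k(\mathbf{x}_n))_{k=1,\dots,K;\; n=1,\dots,N} \in \mathbb{R}^{K \times N}$, let $\mathbf{m} = (I[p_1],\dots,I[p_K])^T$, and let $W = \{\mathbf{w} \in \mathbb{R}^N \mid P\mathbf{w} = \mathbf{m}\}$; this is the set of weight vectors for which the cubature formula (CF) $C_N[f] = \sum_{n=1}^N w_n f(\mathbf{x}_n)$ has degree of exactness $d$, i.e. $C_N[f] = I[f]$ for all $f \in \mathbb{P}_d(\mathbb{R}^q)$. A CF is called nonnegative if all its weights $w_n$ are nonnegative. LS-CF: with $R = \mathrm{diag}(r_1,\dots,r_N)$, $r_n = \omega(\mathbf{x}_n)|\Omega|/N$, its weights are $$\mathbf{w}^{\mathrm{LS}} = \operatorname*{arg\,min}_{\mathbf{w} \in W} \| R^{-1/2}\mathbf{w} \|_2, \qquad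 \text{explicitly} \qquad \mathbf{w}^{\mathrm{LS}} = R P^T (P R P^T)^{-1}\mathbf{m}.$$ The explicit formula is to be taken as the definition of $\mathbf{w}^{\mathrm{LS}}$ if some $r_n$ with $n > N_0$ vanish (so that $R^{-1/2}$ is not defined). $\ell^1$-CF: its weights are $\mathbf{w}^{\ell^1} = \operatorname*{arg\,min}_{\mathbf{w} \in W} \|\mathbf{w}\|_1$, where $\|\mathbf{w}\|_1 = \sum_{n=1}^N |w_n|$; since the minimizer need not be unique, $\mathbf{w}^{\ell^1}$ denotes any minimizer. *)

(* Defs.v *)
From HB Require Import structures.
From mathcomp Require Import all_boot all_order all_algebra.
(* mpoly is imported without its notations, and before mathcomp-analysis, to
   avoid clashes of notations and of names. *)
From mathcomp Require Import -(notations) mpoly.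
From mathcomp Require Import all_classical all_reals all_analysis.

Set Implicit Arguments.
Unset Strict Implicit.
Unset Printing Implicit Defensive.

Import Order.TTheory GRing.Theory Num.Theory.
Import numFieldNormedType.Exports.

Local Open Scope classical_set_scope.
Local Open Scope ring_scope.

Section LebesgueMeasure.
Variables (R : realType) (q : nat).
Implicit Types (A : set 'rV[R]_q) (S : set ('rV[R]_q * 'rV[R]_q)).

Definition box (c : 'rV[R]_q * 'rV[R]_q) : set 'rV[R]_q :=
  [set x | forall i, c.1 ord0 i < x ord0 i <= c.2 ord0 i].

Definition box_volume (c : 'rV[R]_q * 'rV[R]_q) : R :=
  \prod_(i < q) Num.max 0 (c.2 ord0 i - c.1 ord0 i).

Definition box_cover A : set (set ('rV[R]_q * 'rV[R]_q)) :=
  [set S | countable S /\ A `<=` \bigcup_(c in S) box c].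

Definition lebesgue_outer A : \bar R :=
  ereal_inf [set \esum_(c in S) (box_volume c)%:E | S in box_cover A].

Local Open Scope ereal_scope.

Let box_volume_ge0 c : 0 <= (box_volume c)%:E.
Proof. by rewrite lee_fin; apply: prodr_ge0 => i _; rewrite le_max lexx. Qed.

Lemma lebesgue_outer_ge0 A : 0 <= lebesgue_outer A.
Proof. by apply: le_ereal_inf_tmp => _ [S _ <-]; exact: esum_ge0. Qed.

Lemma lebesgue_outer0 : lebesgue_outer set0 = 0.
Proof.
apply/eqP; rewrite eq_le lebesgue_outer_ge0 andbT.
apply: ereal_inf_lbound; exists set0; last exact: esum_set0.
by split => //; exact: sub0set.
Qed.

Lemma le_lebesgue_outer :
  {homo lebesgue_outer : A B / A `<=` B >-> A <= B}.
Proof.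
move=> A B AB; apply: ereal_inf_le_tmp => _ [S [cS BS] <-].
by exists S => //; split => //; exact: subset_trans BS.
Qed.

Let esum_bigcup_le (F : nat -> set ('rV[R]_q * 'rV[R]_q)) :
  \esum_(c in \bigcup_n F n) (box_volume c)%:E <=
  \sum_(n <oo) \esum_(c in F n) (box_volume c)%:E.
Proof.
rewrite seqDU_bigcup_eq esum_bigcupT//.
rewrite -nneseries_esumT; last by move=> n; exact: esum_ge0.
apply: lee_nneseries => [n _ _|n _]; first exact: esum_ge0.
have -> : F n = seqDU F n `|` (F n `\` seqDU F n).
  by rewrite setDUK//; exact: subDsetl.
rewrite [leLHS]esum_mkcond [leRHS]esum_mkcond; apply: le_esum => c _.
by case: ifPn => //= cS; [rewrite ifT// in_setU cS|case: ifPn].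
Qed.

Lemma lebesgue_outer_sigma_subadditive : sigma_subadditive lebesgue_outer.
Proof.
move=> A; have [[i ioo]|] := pselect (exists i, lebesgue_outer (A i) = +oo).
  rewrite (eseries_pinfty _ _ ioo) ?leey// => n _.
  by rewrite -ltNye (lt_le_trans _ (lebesgue_outer_ge0 _)).
rewrite -forallNE => Aoo.
suff add2e (e : {posnum R}) : lebesgue_outer (\bigcup_n A n) <=
    \sum_(i <oo) lebesgue_outer (A i) + e%:num%:E.
  by apply/lee_addgt0Pr => _/posnumP[].
rewrite (le_trans _ (epsilon_trick _ _ _))//; last first.
  by move=> n; exact: lebesgue_outer_ge0.
pose P n S := box_cover (A n) S /\ \esum_(c in S) (box_volume c)%:E <=
  lebesgue_outer (A n) + (e%:num / (2 ^ n.+1)%:R)%:E.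
have [G PG] : {G : nat -> set ('rV[R]_q * 'rV[R]_q) & forall n, P n (G n)}.
  apply: (@choice _ _ P) => n; rewrite /P.
  have en : (0 < e%:num / (2 ^ n.+1)%:R :> R)%R by [].
  have finA : lebesgue_outer (A n) \is a fin_num.
    rewrite ge0_fin_numE ?lebesgue_outer_ge0// ltey; exact/eqP/Aoo.
  have [_ [S AS <-] SA] := lb_ereal_inf_adherent en finA.
  by exists S; split => //; exact/ltW.
apply: (@le_trans _ _ (\esum_(c in \bigcup_n G n) (box_volume c)%:E)).
  apply: ereal_inf_lbound; exists (\bigcup_n G n) => //; split.
    by apply: bigcup_countable => // n _; exact: (PG n).1.1.
  move=> t [n _ /(PG n).1.2[c Gc ct]].
  by exists c => //; exists n.
apply: (le_trans (esum_bigcup_le _)); apply: lee_nneseries => n _.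
  by move=> _; exact: esum_ge0.
exact: (PG n).2.
Qed.

HB.instance Definition _ := isOuterMeasure.Build R 'rV[R]_q lebesgue_outer
  lebesgue_outer0 lebesgue_outer_ge0 le_lebesgue_outer
  lebesgue_outer_sigma_subadditive.

(* Lebesgue measure on R^q, on the sigma-algebra of all Lebesgue measurable
   sets, i.e. the sets that are Caratheodory measurable for lebesgue_outer. *)
Definition lebesgue_Rn : set (caratheodory_type lebesgue_outer) -> \bar R :=
  lebesgue_outer.

Let lebesgue_Rn0 : lebesgue_Rn set0 = 0.
Proof. exact: lebesgue_outer0. Qed.

Let lebesgue_Rn_ge0 A : 0 <= lebesgue_Rn A.
Proof. exact: lebesgue_outer_ge0. Qed.

Let lebesgue_Rn_sigma_additive : semi_sigma_additive lebesgue_Rn.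
Proof.
move=> F mF tF mUF; rewrite /lebesgue_Rn.
exact: caratheodory_measure_sigma_additive.
Qed.

HB.instance Definition _ := isMeasure.Build _ _ _ lebesgue_Rn
  lebesgue_Rn0 lebesgue_Rn_ge0 lebesgue_Rn_sigma_additive.

End LebesgueMeasure.
Arguments lebesgue_outer {R q} A.
Arguments lebesgue_Rn {R q} _.

Section Polynomials.
Variables (R : realType) (q : nat).
Implicit Types (f : mpoly q R) (x : 'rV[R]_q).

Definition peval f x : R := meval (x ord0) f.

(* Polynomials of total degree at most d; [msize f] is the total degree of f
   plus one, and 0 if f = 0. *)
Definition polys (d : nat) : set (mpoly q R) :=
  [set f | (msize f <= d.+1)%N].

Definition unisolvent (d : nat) (X : set 'rV[R]_q) : Prop :=
  forall f, polys d f -> (forall x, X x -> peval f x = 0) -> f = 0.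

Definition basis_of_polys (d K : nat) (p : 'I_K -> mpoly q R) : Prop :=
  [/\ forall k, polys d (p k),
      forall c : 'I_K -> R, \sum_k c k *: p k = 0 -> forall k, c k = 0
    & forall f, polys d f -> exists c : 'I_K -> R, f = \sum_k c k *: p k].

Variables (Omega : set 'rV[R]_q) (omega : 'rV[R]_q -> R).

Definition volume : R := fine (lebesgue_Rn Omega).

Definition weighted_integral (g : 'rV[R]_q -> R) : R :=
  \int[lebesgue_Rn]_(x in Omega) (g x * omega x).

Definition moments (K : nat) (p : 'I_K -> mpoly q R) : 'cV[R]_K :=
  \col_k weighted_integral (peval (p k)).

Section Cubature.
Variables (N : nat) (X : 'I_N -> 'rV[R]_q).

Definition cubature (w : 'cV[R]_N) (g : 'rV[R]_q -> R) : R :=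
  \sum_n w n ord0 * g (X n).

Definition has_exactness (d : nat) (w : 'cV[R]_N) : Prop :=
  forall f, polys d f -> cubature w (peval f) = weighted_integral (peval f).

Definition eval_mx (K : nat) (p : 'I_K -> mpoly q R) : 'M[R]_(K, N) :=
  \matrix_(k, n) peval (p k) (X n).

(* The diagonal of the matrix called R in the LS-CF. *)
Definition ls_scaling : 'rV[R]_N :=
  \row_n (omega (X n) * volume / N%:R).

End Cubature.

End Polynomials.

Section Weights.
Variables (R : realType) (K N : nat).
Implicit Types (P : 'M[R]_(K, N)) (m : 'cV[R]_K) (r : 'rV[R]_N) (w : 'cV[R]_N).

Definition nonnegative_weights w : Prop := forall n, 0 <= w n ord0.

Definition exact_weights P m : set 'cV[R]_N := [set w | P *m w = m].

Definition l1norm w : R := \sum_n `|w n ord0|.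

Definition l2norm w : R := Num.sqrt (\sum_n w n ord0 ^+ 2).

Definition is_argmin (W : set 'cV[R]_N) (F : 'cV[R]_N -> R) w : Prop :=
  W w /\ forall v, W v -> F w <= F v.

Definition inv_sqrt_diag r : 'M[R]_N :=
  diag_mx (map_mx (fun t => (Num.sqrt t)^-1) r).

(* The least-squares weights: the minimizer of the weighted norm if all the
   scaling factors are positive, and the explicit formula (which requires
   P R P^T to be invertible) otherwise. *)
Definition is_ls_weights P r m w : Prop :=
  if [forall n, 0 < r ord0 n] then
    is_argmin (exact_weights P m) (fun v => l2norm (inv_sqrt_diag r *m v)) w
  else
    P *m diag_mx r *m P^T \in unitmx /\
    w = diag_mx r *m P^T *m invmx (P *m diag_mx r *m P^T) *m m.

Definition is_l1_weights P m w : Prop :=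
  is_argmin (exact_weights P m) l1norm w.

End Weights.

(* Main.v *)
Require Import Defs.
From HB Require Import structures.
From mathcomp Require Import all_boot all_order all_algebra.
From mathcomp Require Import -(notations) mpoly.
From mathcomp Require Import all_classical all_reals all_analysis.
From mathcomp Require Import measurable_realfun.
From mathcomp Require Import ring lra.
From mathcomp Require mpoly.

(** The weights come out of the Gram matrices of the basis [p].  Write
    [A_N = P R P^T] for the discrete Gram matrix on the first [N] nodes, [G] for
    the Gram matrix of [p] for the weighted integral, [m] for the moments and
    [c] for the coordinates of the constant polynomial 1, so that [m = G c].
    Unisolvence of the first [N0] nodes makes [A_N] invertible for [N >= N0],
    and the least-squares weights are
      [w_n = r_n q_N(x_n)],  where [q_N] has coordinates [y_N = A_N^-1 m].
    By hypothesis [A_N] converges to [G].  If [G] is invertible, then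
    [A_N y_N = G c] forces [y_N] to converge to [c] ([solution_cvg]), that is,
    [q_N] converges to 1 uniformly on the bounded domain; hence [q_N(x_n) >= 0]
    for all [n] once [N] is large, and the weights are nonnegative
    ([ls_formula_nonneg]).

    Nothing in the hypotheses prevents [omega] from vanishing almost everywhere,
    in which case [G = 0].  This is the only way in which [G] can be singular: if
    [u <> 0] is a polynomial and the weighted integral of [u ^ 2] is 0, then
    [omega] vanishes almost everywhere off the zero set of [u], and this zero set
    is null ([polyfun_zero_null]).  Then [m = 0], so the least-squares weights
    are 0 ([weighted_integral_degenerate], [gram_unit]).

    The zero set [Z] of a nonconstant polynomial [f] is null by induction on the
    degree: translate it along a vector [h] with [f (y + h) - f y] not
    identically 0.  Where [Z] meets its translate by [t],
    the difference [f (y + t) - f y], of lower degree, vanishes.  So, for any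
    [N], the [N] translates of a bounded part of [Z] by multiples of [h / N] have
    the same measure and null pairwise intersections, and they all lie in one
    bounded set: their common measure is 0.

    Finally, exactness on constants gives all exact weight vectors the same sum.
    A nonnegative exact vector, such as the least-squares one, has its l1-norm
    equal to this sum, which is a lower bound of the l1-norm on exact vectors;
    so the minimizers are precisely the nonnegative exact vectors
    ([l1_weights_nonneg]). *)

Set Implicit Arguments.
Unset Strict Implicit.
Unset Printing Implicit Defensive.

Import Order.TTheory GRing.Theory Num.Theory.
Import numFieldNormedType.Exports.

Local Open Scope classical_set_scope.
Local Open Scope ring_scope.

(** * Lebesgue outer measure: translations and measurable coordinates *)

Section OuterMeasure.
Variables (R : realType) (q : nat).
Implicit Types (A B : set 'rV[R]_q) (S : set ('rV[R]_q * 'rV[R]_q)).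


Lemma box_volume_ge0 (c : 'rV[R]_q * 'rV[R]_q) : 0 <= box_volume c.
Proof. by apply: prodr_ge0 => i _; rewrite le_max lexx. Qed.

(** Covers are indexed by sets of boxes, and a map [e] on boxes need not be
    injective: passing to a section of [e] on the image only drops terms of the
    sum.  Translating and cutting covers are both of this form. *)
Lemma lebesgue_outer_le_cover A S
    (e : 'rV[R]_q * 'rV[R]_q -> 'rV[R]_q * 'rV[R]_q) :
  countable S -> A `<=` \bigcup_(c in S) box (e c) ->
  (lebesgue_outer A <= \esum_(c in S) (box_volume (e c))%:E)%E.
Proof.
move=> cS AS; have /choice[s sP] (b : 'rV[R]_q * 'rV[R]_q) :
    exists c, (e @` S) b -> S c /\ e c = b.
  by have [[c Sc <-]|] := pselect ((e @` S) b); [exists c|exists b].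
apply: (@le_trans _ _ (\esum_(b in e @` S) (box_volume b)%:E)).
  apply: ereal_inf_lbound; exists (e @` S) => //; split.
    exact: card_le_trans (card_image_le _ _) cS.
  by move=> x /AS[c Sc cx]; exists (e c) => //; exists c.
rewrite (eq_esum (b := fun b => (box_volume (e (s b)))%:E)); last first.
  by move=> b /sP[_ ->].
rewrite -(esum_image _ s (fun c => (box_volume (e c))%:E)); last first.
  move=> b b'; rewrite !inE => /sP[_ eb] /sP[_ eb'] ss.
  by rewrite -eb -eb' ss.
rewrite [leLHS]esum_mkcond [leRHS]esum_mkcond; apply: le_esum => c _.
case: ifPn => [|_]; last by case: ifPn => // _; rewrite lee_fin box_volume_ge0.
by rewrite inE => -[b /sP[Sb _] <-]; rewrite mem_set.
Qed.

Lemma lebesgue_outer_translate_le A (h : 'rV[R]_q) :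
  (lebesgue_outer [set y | A (y + h)%R] <= lebesgue_outer A)%E.
Proof.
apply: le_ereal_inf_tmp => _ [S [cS AS] <-].
pose e (c : 'rV[R]_q * 'rV[R]_q) := (c.1 - h, c.2 - h).
rewrite [leRHS](eq_esum (b := fun c => (box_volume (e c))%:E)); last first.
  move=> c _; congr (_%:E); apply: eq_bigr => i _ /=.
  by rewrite !mxE; congr (Num.max 0 _); ring.
apply: lebesgue_outer_le_cover => // y /AS[c Sc cy]; exists c => // i.
by have := cy i; rewrite /= !mxE ltrBlDr lerBrDr.
Qed.

Lemma lebesgue_outer_translate A (h : 'rV[R]_q) :
  lebesgue_outer [set y | A (y + h)] = lebesgue_outer A.
Proof.
apply/eqP; rewrite eq_le lebesgue_outer_translate_le /=.
have := lebesgue_outer_translate_le [set y | A (y + h)] (- h).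
by apply: le_trans; apply: le_lebesgue_outer => y Ay /=; rewrite subrK.
Qed.

Lemma lebesgue_outer_bounded A (M : R) :
  (forall y, A y -> forall i, `|y ord0 i| <= M) ->
  (lebesgue_outer A < +oo)%E.
Proof.
move=> AM; pose c : 'rV[R]_q * 'rV[R]_q := (const_mx (- M - 1), const_mx M).
apply: (@le_lt_trans _ _ (\esum_(b in [set c]) (box_volume b)%:E)%E).
  apply: (lebesgue_outer_le_cover (e := id)) => // y /AM yM.
  exists c => // i; rewrite !mxE; have := yM i; rewrite ler_norml => /andP[? ?].
  by apply/andP; split => //; lra.
by rewrite esum_set1 ?ltry// lee_fin box_volume_ge0.
Qed.

(** The two halves of a box cut by the hyperplane where coordinate [i] is [a];
    one of them may have reversed bounds, hence volume 0. *)
Let le_part (i : 'I_q) (a : R) (c : 'rV[R]_q * 'rV[R]_q) :=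
  (c.1, \row_j if j == i then Num.min (c.2 ord0 j) a else c.2 ord0 j).
Let gt_part (i : 'I_q) (a : R) (c : 'rV[R]_q * 'rV[R]_q) :=
  (\row_j (if j == i then Num.max (c.1 ord0 j) a else c.1 ord0 j), c.2).

Let box_volume_split i a c :
  box_volume c = box_volume (le_part i a c) + box_volume (gt_part i a c).
Proof.
rewrite /box_volume (bigD1 i)//= [in RHS](bigD1 i)//=.
rewrite [X in _ = _ + X](bigD1 i)//= !mxE eqxx.
rewrite [in X in _ = X + _](eq_bigr (fun j => Num.max 0 (c.2 ord0 j - c.1 ord0 j))).
  rewrite [in X in _ = _ + X](eq_bigr (fun j => Num.max 0 (c.2 ord0 j - c.1 ord0 j))).
    rewrite -mulrDl; congr (_ * _).
    by rewrite !maxEle !minEle; do ![case: ifPn]; rewrite -?ltNge => *; lra.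
  by move=> j ji; rewrite !mxE (negbTE ji).
by move=> j ji; rewrite !mxE (negbTE ji).
Qed.

(** Cutting every box of a cover along the hyperplane gives covers of the two
    parts of [A] without changing the total volume. *)
Lemma measurable_half_space (i : 'I_q) (a : R) :
  lebesgue_outer.-cara.-measurable [set y : 'rV[R]_q | y ord0 i > a].
Proof.
apply: le_caratheodory_measurable => A.
apply: le_ereal_inf_tmp => _ [S [cS AS] <-].
rewrite (eq_esum (b := fun c => (box_volume (gt_part i a c))%:E
    + (box_volume (le_part i a c))%:E)%E); last first.
  by move=> c _; rewrite -EFinD (box_volume_split i a) addrC.
rewrite esumD; [|by move=> c _; rewrite lee_fin box_volume_ge0..].
apply: leeD; apply: lebesgue_outer_le_cover => //.
  move=> y [/AS[c Sc cy] /= ay]; exists c => // j; rewrite !mxE.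
  by have := cy j; case: eqP => // ->; rewrite gt_max ay andbT.
move=> y [/AS[c Sc cy] /= /negP]; rewrite -leNgt => ya; exists c => // j.
by rewrite !mxE; have := cy j; case: eqP => // ->; rewrite le_min ya andbT.
Qed.

Lemma measurable_coord (i : 'I_q) :
  measurable_fun setT
    ((fun y => y ord0 i) : caratheodory_type (@lebesgue_outer R q) -> R).
Proof.
apply: (measurability _ (RGenOInfty.measurableE R)) => //.
move=> _ [_ [a ->] <-]; rewrite setTI.
have := measurable_half_space i a; congr (_.-cara.-measurable _).
by apply/seteqP; split => y /=; rewrite in_itv /= andbT.
Qed.

End OuterMeasure.

(** * Polynomial functions and their finite differences *)

Section PolynomialFunctions.
Variables (R : realType) (q : nat).
Local Notation rV := 'rV[R]_q.
Implicit Types (f g : rV -> R) (h y : rV).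

(** The functions of [R^q] given by polynomials.  Membership is an induction
    principle: each analytic property of polynomials used below needs only to be
    checked on constants, coordinates, sums and products. *)
Inductive polyfun : (rV -> R) -> Prop :=
| PolyConst c : polyfun (fun=> c)
| PolyCoord i : polyfun (fun y => y ord0 i)
| PolyAdd f g : polyfun f -> polyfun g -> polyfun (fun y => f y + g y)
| PolyMul f g : polyfun f -> polyfun g -> polyfun (fun y => f y * g y).

Lemma polyfun_peval (u : mpoly q R) : polyfun (peval u).
Proof.
have sumP (I : Type) (s : seq I) (F : I -> rV -> R) :
    (forall i, polyfun (F i)) -> polyfun (fun y => \sum_(i <- s) F i y).
  move=> FP; elim: s => [|i s IH].
    by under eq_fun do rewrite big_nil; exact: PolyConst.
  by under eq_fun do rewrite big_cons; exact: PolyAdd.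
have prodP (I : Type) (s : seq I) (F : I -> rV -> R) :
    (forall i, polyfun (F i)) -> polyfun (fun y => \prod_(i <- s) F i y).
  move=> FP; elim: s => [|i s IH].
    by under eq_fun do rewrite big_nil; exact: PolyConst.
  by under eq_fun do rewrite big_cons; exact: PolyMul.
rewrite (_ : peval u = fun y => meval (y ord0) u)//.
under eq_fun do rewrite mevalE.
apply: sumP => mm; apply: PolyMul; first exact: PolyConst.
apply: prodP => i; elim: (mm i) => [|n IH].
  by under eq_fun do rewrite expr0; exact: PolyConst.
by under eq_fun do rewrite exprS; apply: PolyMul => //; exact: PolyCoord.
Qed.

Lemma polyfun_shift f h : polyfun f -> polyfun (fun y => f (y + h)).
Proof.
elim=> [c|i|{}f g _ IHf _ IHg|{}f g _ IHf _ IHg];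
  [exact: PolyConst| |exact: PolyAdd|exact: PolyMul].
under eq_fun do rewrite mxE.
by apply: PolyAdd; [exact: PolyCoord|exact: PolyConst].
Qed.

Lemma polyfun_measurable f : polyfun f ->
  measurable_fun setT (f : caratheodory_type (@lebesgue_outer R q) -> R).
Proof.
elim=> [c|i|{}f g _ IHf _ IHg|{}f g _ IHf _ IHg].
- exact: measurable_cst.
- exact: measurable_coord.
- exact: measurable_funD.
- exact: measurable_funM.
Qed.

Lemma polyfun_bounded f (M : R) : polyfun f ->
  exists B, forall y, (forall i, `|y ord0 i| <= M) -> `|f y| <= B.
Proof.
elim=> [c|i|{}f g _ [B1 IHf] _ [B2 IHg]|{}f g _ [B1 IHf] _ [B2 IHg]].
- by exists `|c|.
- by exists M.
- by exists (B1 + B2) => y yM; rewrite (le_trans (ler_normD _ _))// lerD ?IHf ?IHg.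
- by exists (B1 * B2) => y yM; rewrite normrM ler_pM ?IHf ?IHg.
Qed.

Definition fdiff h f : rV -> R := fun y => f (y + h) - f y.

(** For a polynomial function, this says that the degree is less than [n]; it is a
    notion of degree that differences lower by definition. *)
Fixpoint fdiff_vanish (n : nat) f : Prop :=
  if n is n'.+1 then forall h, fdiff_vanish n' (fdiff h f) else forall y, f y = 0.

Lemma polyfun_diff f h : polyfun f -> polyfun (fdiff h f).
Proof.
move=> fP; apply: PolyAdd; first exact: polyfun_shift.
under eq_fun do rewrite -mulN1r.
by apply: PolyMul => //; exact: PolyConst.
Qed.

Lemma eq_fdiff_vanish n f g : f =1 g -> fdiff_vanish n f -> fdiff_vanish n g.
Proof. by move=> /funext ->. Qed.

Lemma fdiff_vanish0 n : fdiff_vanish n (fun=> 0).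
Proof.
elim: n => //= n IH h; apply: eq_fdiff_vanish IH => y.
by rewrite /fdiff subrr.
Qed.

Lemma fdiff_vanishD n f g :
  fdiff_vanish n f -> fdiff_vanish n g -> fdiff_vanish n (fun y => f y + g y).
Proof.
elim: n f g => [|n IH] f g /= f0 g0; first by move=> y; rewrite f0 g0 addr0.
move=> h; apply: eq_fdiff_vanish (IH _ _ (f0 h) (g0 h)) => y.
by rewrite /fdiff; ring.
Qed.

Lemma fdiff_vanishS n f : fdiff_vanish n f -> fdiff_vanish n.+1 f.
Proof.
elim: n f => [|n IH] f /= f0 h; first by move=> y; rewrite /fdiff !f0 subrr.
exact/IH/f0.
Qed.

Lemma fdiff_vanish_le n m f : (n <= m)%N -> fdiff_vanish n f -> fdiff_vanish m f.
Proof.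
by move=> /subnK <-; elim: (m - n)%N => // k IH /IH; exact: fdiff_vanishS.
Qed.

Lemma fdiff_vanish_shift n f h :
  fdiff_vanish n f -> fdiff_vanish n (fun y => f (y + h)).
Proof.
elim: n f => [|n IH] f /= f0; first by move=> y; rewrite f0.
move=> k; apply: eq_fdiff_vanish (IH _ (f0 k)) => y.
by rewrite /fdiff addrAC.
Qed.

(** The discrete Leibniz rule
    [fdiff h (f g) = f * fdiff h g + fdiff h f * g (_ + h)]
    lowers one of the two orders in each term. *)
Lemma fdiff_vanishM n m f g : fdiff_vanish n f -> fdiff_vanish m g ->
  fdiff_vanish (n + m) (fun y => f y * g y).
Proof.
have [k] := ubnP (n + m)%N; elim: k n m f g => // k IH [|n] [|m] f g nm fn gm;
  rewrite ?ltnS in nm.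
- by move=> y /=; rewrite fn mul0r.
- suff -> : (fun y => f y * g y) = (fun=> 0) by exact: fdiff_vanish0.
  by apply/funext => y; rewrite fn mul0r.
- suff -> : (fun y => f y * g y) = (fun=> 0) by exact: fdiff_vanish0.
  by apply/funext => y; rewrite gm mulr0.
rewrite addSn in nm *; move=> h.
have H1 := IH _ _ _ _ _ fn (gm h).
have H2 := IH _ _ _ _ nm (fn h) (fdiff_vanish_shift h gm).
rewrite addSnnS in H1.
refine (eq_fdiff_vanish _ (fdiff_vanishD (H1 nm) H2)) => y.
by rewrite /fdiff; ring.
Qed.

Lemma polyfun_fdiff_vanish f : polyfun f -> exists n, fdiff_vanish n f.
Proof.
have cst c : fdiff_vanish 1 (fun=> c) by move=> h y; rewrite /fdiff subrr.
elim=> [c|i|{}f g _ [n IHf] _ [m IHg]|{}f g _ [n IHf] _ [m IHg]].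
- by exists 1%N.
- exists 2%N => h; apply: eq_fdiff_vanish (cst (h ord0 i)) => y.
  by rewrite /fdiff !mxE; ring.
- exists (maxn n m); apply: fdiff_vanishD.
    by apply: fdiff_vanish_le IHf; rewrite leq_maxl.
  by apply: fdiff_vanish_le IHg; rewrite leq_maxr.
- by exists (n + m)%N; exact: fdiff_vanishM.
Qed.

Lemma diff_mulrn0 h k f : (forall y, fdiff h f y = 0) ->
  forall y, f (y + h *+ k) = f y.
Proof.
move=> f0; elim: k => [|k IH] y; first by rewrite addr0.
by rewrite mulrSr addrA -[RHS]IH; apply/eqP; rewrite -subr_eq0; apply/eqP/f0.
Qed.

(** A polynomial with period [h *+ k] along [h] has period [h]: by induction
    [fdiff h f] has period [h], so [f] is arithmetic along [y + h *+ j], with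
    step [fdiff h f y]; as it takes the same value at [j = 0] and [j = k], the
    step is 0. *)
Lemma fdiff_vanish_periodic n f h k : fdiff_vanish n f -> (0 < k)%N ->
  (forall y, fdiff (h *+ k) f y = 0) -> forall y, fdiff h f y = 0.
Proof.
move=> + k0; elim: n f => [|n IH] f /= fn fk.
  by move=> y; rewrite /fdiff !fn subrr.
have g0 : forall y, fdiff h (fdiff h f) y = 0.
  apply: IH => // y; rewrite /fdiff.
  have := fk y; have := fk (y + h); rewrite /fdiff => /subr0_eq + /subr0_eq.
  by rewrite addrAC => -> ->; rewrite subrr.
move=> y; have sumE j : f (y + h *+ j) - f y = fdiff h f y *+ j.
  elim: j => [|j IHj]; first by rewrite addr0 subrr.
  have := diff_mulrn0 j g0 y; rewrite {1}/fdiff -addrA -mulrSr => e.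
  by rewrite [RHS]mulrSr -IHj -e; ring.
have := fk y; rewrite /fdiff sumE => /eqP.
by rewrite mulrn_eq0 gtn_eqF//= => /eqP.
Qed.

End PolynomialFunctions.

(** * Zero sets of polynomials are null *)

Section NullZeroSets.
Variables (R : realType) (q : nat).
Local Notation rV := 'rV[R]_q.
Implicit Types (f g : rV -> R) (h y : rV) (A : set rV).

Lemma lebesgue_outer_null_bigcup (F : nat -> set rV) :
  (forall i, lebesgue_outer (F i) = 0%E) -> lebesgue_outer (\bigcup_i F i) = 0%E.
Proof.
move=> F0; apply/eqP; rewrite eq_le lebesgue_outer_ge0 andbT.
apply: (le_trans (lebesgue_outer_sigma_subadditive F)).
by rewrite eseries0.
Qed.

Lemma lebesgue_outer_null_sub A (B : set rV) :
  A `<=` B -> lebesgue_outer B = 0%E -> lebesgue_outer A = 0%E.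
Proof.
move=> AB B0; apply/eqP; rewrite eq_le lebesgue_outer_ge0 andbT -B0.
exact: le_lebesgue_outer.
Qed.

Lemma lebesgue_outer_leU A (B : set rV) : 
  (lebesgue_outer (A `|` B) <= lebesgue_outer A + lebesgue_outer B)%E.
Proof. exact: outer_measureU2. Qed.

Lemma polyfun_zero_measurable f : polyfun f ->
  lebesgue_outer.-cara.-measurable [set y | f y = 0].
Proof.
move=> /polyfun_measurable fm; have := fm measurableT [set 0] (measurable_set1 0).
by rewrite setTI.
Qed.

(** By induction on the degree bound [n].  The bounded part [A M] of the zero set
    has [N] translates, by multiples of [t = h / N], inside the fixed bounded set
    [D]; two of them meet inside a translate of the zero set of
    [fdiff (t *+ k) f], null by induction.  Hence [N] times the measure of [A M]
    is at most the measure of [D], for every [N].  The step [t] must shrink with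
    [N] to keep [D] fixed; that [fdiff (t *+ k) f] is still nonzero follows from
    [fdiff_vanish_periodic], since [h] is a multiple of [t]. *)
Lemma polyfun_zero_null n f : polyfun f -> fdiff_vanish n f ->
  (exists y, f y != 0) -> lebesgue_outer [set y | f y = 0] = 0%E.
Proof.
elim: n f => [|n IH] f fP /= fn [y0 fy0]; first by rewrite fn eqxx in fy0.
(* If every difference of f vanishes, then f is a nonzero constant. *)
have [[h [y1 hy1]]|noh] := pselect (exists h y, fdiff h f y != 0); last first.
  apply: (@lebesgue_outer_null_sub _ set0); last exact: lebesgue_outer0.
  move=> y /= fy; apply: noh; exists (y0 - y), y.
  by rewrite /fdiff (addrC y) subrK fy subr0.
pose A (M : nat) := [set y | f y = 0 /\ forall i, `|y ord0 i| <= M%:R].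
suff A0 M : lebesgue_outer (A M) = 0%E.
  apply: (@lebesgue_outer_null_sub _ (\bigcup_M A M)).
    move=> y /= fy; exists (Num.truncn (\sum_i `|y ord0 i|)).+1 => //.
    split => // i; apply: le_trans (ltW (truncnS_gt _)).
    by rewrite (bigD1 i)//= lerDl sumr_ge0.
  exact: lebesgue_outer_null_bigcup.
pose H := \sum_i `|h ord0 i|.
have Hi i : `|h ord0 i| <= H by rewrite /H (bigD1 i)//= lerDl sumr_ge0.
pose D := [set y : rV | forall i, `|y ord0 i| <= M%:R + H].
have fin (S : set rV) (B : R) : (forall y, S y -> forall i, `|y ord0 i| <= B) ->
    lebesgue_outer S = (fine (lebesgue_outer S))%:E.
  move=> SB; rewrite fineK// ge0_fin_numE ?lebesgue_outer_ge0//.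
  exact: lebesgue_outer_bounded SB.
have AE := fin (A M) M%:R (fun y yA => yA.2).
have DE := fin D (M%:R + H) (fun y yD => yD).
set c := fine (lebesgue_outer (A M)) in AE.
set e := fine (lebesgue_outer D) in DE.
have c0 : 0 <= c by rewrite -lee_fin -AE lebesgue_outer_ge0.
suff main (N : nat) : (0 < N)%N -> c * N%:R <= e.
  rewrite AE; congr (_%:E); apply/eqP; rewrite eq_le c0 andbT leNgt.
  apply/negP => c_gt0; have := main (Num.truncn (e / c)).+1 isT.
  by rewrite mulrC -ler_pdivlMr// leNgt truncnS_gt.
move=> N0; pose t := N%:R^-1 *: h.
have tN : t *+ N = h.
  by rewrite /t -scaler_nat scalerA mulfV ?scale1r// pnatr_eq0 -lt0n.
pose T j := [set y : rV | A M (y + t *+ j)].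
pose Z j := [set y : rV | f (y + t *+ j) = 0].
have TE j : lebesgue_outer (T j) = c%:E by rewrite lebesgue_outer_translate.
have Zm j : lebesgue_outer.-cara.-measurable (Z j).
  by apply: polyfun_zero_measurable; exact: polyfun_shift.
(* On the intersection, f agrees at two points that differ by t *+ k. *)
have Z0 i j : (i < j)%N -> lebesgue_outer (Z i `&` Z j) = 0%E.
  move=> ij; pose k := (j - i)%N.
  apply: (@lebesgue_outer_null_sub _
      [set y | [set y | fdiff (t *+ k) f y = 0] (y + t *+ i)]).
    move=> y [/= fi fj]; rewrite /fdiff fi subr0 -addrA -mulrnDr.
    by rewrite subnKC// ltnW.
  rewrite lebesgue_outer_translate; apply: IH; first exact: polyfun_diff.
    exact: fn.
  apply: contrapT => nz; move/negP: hy1; apply; apply/eqP.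
  have dk : forall y, fdiff (t *+ k) f y = 0.
    by move=> y; apply/eqP/negPn/negP => nzy; apply: nz; exists y.
  have dt := @fdiff_vanish_periodic _ _ n.+1 f t k fn.
  rewrite subn_gt0 in dt; have {}dt := dt ij dk.
  by rewrite /fdiff -tN diff_mulrn0// subrr.
pose U j := [set y | exists2 i, (i < j)%N & T i y].
(* The zero set Z j is measurable and contains T j, so it cuts T j off the union;
   the earlier translates meet it in a null set, hence keep their measure. *)
have U_ge j : ((c *+ j)%:E <= lebesgue_outer (U j))%E.
  elim: j => [|j IHj]; first exact: lebesgue_outer_ge0.
  rewrite mulrS EFinD [leRHS](Zm j); apply: leeD.
    rewrite -(TE j); apply: le_lebesgue_outer => y Ty; split; last exact: Ty.1.
    by exists j.
  apply: (le_trans IHj); rewrite [leLHS](Zm j).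
  rewrite [X in (X + _)%E](_ : _ = 0%E) ?add0e.
    apply: le_lebesgue_outer => y [[i ij Ti] nZ]; split => //; exists i => //.
    by rewrite ltnS ltnW.
  apply: (@lebesgue_outer_null_sub _
      (\bigcup_i (if (i < j)%N then Z i `&` Z j else set0))).
    by move=> y [[i ij Ti] Zy]; exists i => //; rewrite ij; split=> //; exact: Ti.1.
  apply: lebesgue_outer_null_bigcup => i.
  by case: ifPn => [/Z0//|_]; exact: lebesgue_outer0.
have := U_ge N; rewrite -lee_fin -DE mulr_natr => /le_trans; apply.
apply: le_lebesgue_outer => y [j jN [_ yM]] i.
have -> : y ord0 i = (y + t *+ j) ord0 i - (t *+ j) ord0 i.
  by rewrite -[X in _ - X]opprK; rewrite !mxE; ring.
rewrite (le_trans (ler_normB _ _))// lerD// (le_trans _ (Hi i))//.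
rewrite -tN !mulmxnE !normrMn -mulr_natl -[leRHS]mulr_natl.
by rewrite ler_wpM2r// ler_nat ltnW.
Qed.

End NullZeroSets.

(** * Weighted integrals of polynomials over a bounded domain *)

Section DegenerateWeight.
Variables (R : realType) (q : nat) (Omega : set 'rV[R]_q).
Variable (omega : 'rV[R]_q -> R).
Hypothesis bounded_Omega : bounded_set Omega.
Hypothesis measurable_Omega : lebesgue_outer.-cara.-measurable Omega.
Hypothesis omega_ge0 : forall y, Omega y -> 0 <= omega y.
Hypothesis integrable_omega : lebesgue_Rn.-integrable Omega (EFin \o omega).
Implicit Types f g : 'rV[R]_q -> R.


Lemma bounded_coord : exists M, forall y, Omega y -> forall i, `|y ord0 i| <= M.
Proof.
have [M [Mr MO]] := bounded_Omega.
exists (M + 1) => y Oy i.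
have : `|y| <= M + 1 by apply: MO => //; rewrite ltrDl.
apply: le_trans; rewrite [`|y|]mx_normrE.
exact: (le_bigmax _ (fun ij : 'I_1 * 'I_q => `|y ij.1 ij.2|) (ord0, i)).
Qed.

Lemma polyfun_bounded_domain f :
  polyfun f -> exists B, forall y, Omega y -> `|f y| <= B.
Proof.
move=> fP; have [M MO] := bounded_coord.
by have [B fB] := polyfun_bounded M fP; exists B => y /MO; exact: fB.
Qed.

Let measurable_weighted f : polyfun f ->
  measurable_fun (Omega : set (caratheodory_type (@lebesgue_outer R q)))
    (fun y => (f y * omega y)%:E).
Proof.
move=> fP; apply/measurable_EFinP; apply: measurable_funM.
  exact/measurable_funTS/polyfun_measurable.
exact/measurable_EFinP/(measurable_int _ integrable_omega).
Qed.

Lemma integrable_weighted f : polyfun f ->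
  lebesgue_Rn.-integrable Omega (fun y => (f y * omega y)%:E).
Proof.
move=> fP; have [B fB] := polyfun_bounded_domain fP.
apply: le_integrable (integrableZl measurable_Omega B integrable_omega) => //.
  exact: measurable_weighted.
move=> y Oy /=; rewrite lee_fin !normrM ler_wpM2r//.
exact: le_trans (fB y Oy) (ler_norm _).
Qed.

(** The integrand [f ^ 2 * omega] is nonnegative with integral 0, so it vanishes
    almost everywhere; as the zero set of [f] is null, [omega] itself vanishes
    almost everywhere, and every weighted integral is 0. *)
Lemma weighted_integral_degenerate f g : polyfun f -> polyfun g ->
  (exists y, f y != 0) ->
  weighted_integral Omega omega (fun y => f y * f y) = 0 ->
  weighted_integral Omega omega g = 0.
Proof.
move=> fP gP fn0 If0.
have ffP := PolyMul fP fP.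
(* Integrability is what turns the vanishing of the real-valued integral, which
   is also 0 for an infinite integral, into that of the extended one. *)
have F0 : (\int[lebesgue_Rn]_(y in Omega) (f y * f y * omega y)%:E = 0)%E.
  rewrite -[LHS]fineK; last first.
    by apply: integrable_fin_num => //; exact: integrable_weighted.
  by congr (_%:E).
have Fabs : (\int[lebesgue_Rn]_(y in Omega) `|(f y * f y * omega y)%:E| = 0)%E.
  rewrite -[RHS]F0; apply: eq_integral => y; rewrite inE => Oy.
  by rewrite gee0_abs// lee_fin mulr_ge0 ?omega_ge0// -expr2 sqr_ge0.
have [+ _] := ae_eq_integral_abs lebesgue_Rn measurable_Omega (measurable_weighted ffP).
move=> /(_ Fabs)[E [mE E0 EO]].
rewrite /weighted_integral /Rintegral (ae_eq_integral (cst 0%E)) ?integral0//.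
  exact: measurable_weighted.
exists (E `|` [set y | f y = 0]); split.
- by apply: measurableU => //; exact: polyfun_zero_measurable.
- have [n fn] := polyfun_fdiff_vanish fP.
  have Z0 := polyfun_zero_null fP fn fn0.
  apply/eqP; rewrite eq_le lebesgue_outer_ge0 andbT.
  by apply: (le_trans (lebesgue_outer_leU _ _)); rewrite Z0 adde0 -E0.
- move=> y /=; have [fy0|fy0] := eqVneq (f y) 0; first by right.
  move=> ny; left; apply: EO => /= H; apply: ny => Oy.
  have := H Oy => -[] /eqP; rewrite !mulf_eq0 (negbTE fy0)/= => /eqP ->.
  by rewrite mulr0.
Qed.

Lemma weighted_integralZD (c : R) f g : polyfun f -> polyfun g ->
  weighted_integral Omega omega (fun y => c * f y + g y) =
  c * weighted_integral Omega omega f + weighted_integral Omega omega g.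
Proof.
move=> fP gP; rewrite /weighted_integral.
under eq_Rintegral do rewrite mulrDl -mulrA.
rewrite RintegralD//; last exact: integrable_weighted.
  by rewrite RintegralZl//; exact: integrable_weighted.
under eq_fun do rewrite /= mulrA.
by apply: integrable_weighted; apply: PolyMul => //; exact: PolyConst.
Qed.

Lemma weighted_integral_sum (I : Type) (s : seq I) (c : I -> R)
    (f : I -> 'rV[R]_q -> R) : (forall i, polyfun (f i)) ->
  weighted_integral Omega omega (fun y => \sum_(i <- s) c i * f i y) =
  \sum_(i <- s) c i * weighted_integral Omega omega (f i).
Proof.
move=> fP; elim: s => [|i s IH].
  rewrite big_nil /weighted_integral.
  under eq_Rintegral do rewrite big_nil mul0r.
  by rewrite /Rintegral integral0.
rewrite big_cons -IH -weighted_integralZD//.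
  by congr weighted_integral; apply/funext => y; rewrite big_cons.
elim: s {IH} => [|j s IH].
  by under eq_fun do rewrite big_nil; exact: PolyConst.
under eq_fun do rewrite big_cons.
by apply: PolyAdd => //; apply: PolyMul => //; exact: PolyConst.
Qed.

End DegenerateWeight.

(** * Least-squares and l1 weights *)

Section WeightVectors.
Variables (R : realType) (K N : nat).
Implicit Types (P : 'M[R]_(K, N)) (m : 'cV[R]_K) (r : 'rV[R]_N).
Implicit Types (v w z : 'cV[R]_N).

Definition ls_formula P r m : 'cV[R]_N :=
  diag_mx r *m P^T *m invmx (P *m diag_mx r *m P^T) *m m.

Lemma ls_formula_exact P r m : P *m diag_mx r *m P^T \in unitmx ->
  P *m ls_formula P r m = m.
Proof. by move=> AU; rewrite /ls_formula !mulmxA mulmxV// mul1mx. Qed.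

Let l2norm_scaled r v : (forall n, 0 < r ord0 n) ->
  l2norm (inv_sqrt_diag r *m v) = Num.sqrt (\sum_n v n ord0 ^+ 2 / r ord0 n).
Proof.
move=> r0; congr (Num.sqrt _); apply: eq_bigr => n _.
rewrite mul_diag_mx !mxE exprMn exprVn sqr_sqrtr ?(ltW (r0 n))//.
by rewrite mulrC.
Qed.

(** With [w = R P^T y], the cross term is [y^T P (v - w)], which is 0 because [v]
    and [w] are both exact. *)
Let ls_pythagoras P r m v : (forall n, 0 < r ord0 n) ->
  P *m diag_mx r *m P^T \in unitmx -> P *m v = m ->
  let w := ls_formula P r m in
  \sum_n v n ord0 ^+ 2 / r ord0 n =
  \sum_n w n ord0 ^+ 2 / r ord0 n +
  \sum_n (v n ord0 - w n ord0) ^+ 2 / r ord0 n.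
Proof.
move=> r0 AU Pv w; pose y := invmx (P *m diag_mx r *m P^T) *m m.
have wE : w = diag_mx r *m (P^T *m y) by rewrite /w /ls_formula !mulmxA.
have Pw : P *m w = m by exact: ls_formula_exact.
have cross : \sum_n (w n ord0 / r ord0 n) * (v n ord0 - w n ord0) = 0.
  have : (y^T *m (P *m (v - w))) ord0 ord0 = 0.
    by rewrite mulmxBr Pv Pw subrr mulmx0 mxE.
  rewrite mulmxA mxE => e; rewrite -[RHS]e; apply: eq_bigr => n _.
  rewrite -[P]trmxK -trmx_mul [(P^T *m y)^T _ _]mxE [(v - w) _ _]mxE [(- w) _ _]mxE.
  congr (_ * _); rewrite wE mul_diag_mx mxE [X in X = _]mulrC mulrA mulVf ?mul1r//.
  by rewrite gt_eqF.
have cross2 : 2 * (\sum_n (w n ord0 / r ord0 n) * (v n ord0 - w n ord0)) = 0.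
  by rewrite cross mulr0.
rewrite -[RHS]addr0 -[X in _ = _ + X]cross2 mulr_sumr -!big_split /=.
apply: eq_bigr => n _.
have := lt0r_neq0 (r0 n).
move: (r ord0 n) (v n ord0) (w n ord0) => a b e a0.
by field.
Qed.

(** By the Pythagorean identity, the explicit formula is the unique minimizer
    whenever the minimization problem makes sense. *)
Lemma ls_weights_formula P r m : P *m diag_mx r *m P^T \in unitmx ->
  is_ls_weights P r m (ls_formula P r m) /\
  forall v, is_ls_weights P r m v -> v = ls_formula P r m.
Proof.
move=> AU; rewrite /is_ls_weights; case: ifPn => [/forallP r0|_]; last first.
  by split => // v [].
have Q0 z : 0 <= \sum_n z n ord0 ^+ 2 / r ord0 n.
  by apply: sumr_ge0 => n _; rewrite divr_ge0 ?sqr_ge0// ltW.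
have Q0B z w : 0 <= \sum_n (z n ord0 - w n ord0) ^+ 2 / r ord0 n.
  by apply: sumr_ge0 => n _; rewrite divr_ge0 ?sqr_ge0// ltW.
have Wls := ls_formula_exact m AU.
split=> [|v [Wv vmin]].
  split=> // v Wv; rewrite !l2norm_scaled// ler_sqrt//.
  by rewrite (ls_pythagoras r0 AU Wv) lerDl.
have := vmin _ Wls; rewrite !l2norm_scaled// ler_sqrt//.
rewrite (ls_pythagoras r0 AU Wv) gerDl => vw0.
have /eqP : \sum_n (v n ord0 - ls_formula P r m n ord0) ^+ 2 / r ord0 n = 0.
  by apply/eqP; rewrite eq_le vw0 Q0B.
rewrite psumr_eq0 => [/allP vw|n _]; last by rewrite divr_ge0 ?sqr_ge0// ltW.
apply/colP => n; apply/eqP; rewrite -subr_eq0.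
have := vw n (mem_index_enum _); rewrite /= mulf_eq0 sqrf_eq0 => /orP[//|].
by rewrite invr_eq0 gt_eqF.
Qed.

(** The common sum of the exact vectors is a lower bound of their l1-norm, with
    equality exactly at the nonnegative ones; [w] shows that it is attained. *)
Lemma l1_weights_nonneg P m w :
  (forall v, P *m v = m -> \sum_n v n ord0 = \sum_n w n ord0) ->
  P *m w = m -> nonnegative_weights w ->
  is_l1_weights P m w /\
  forall v, is_l1_weights P m v -> nonnegative_weights v.
Proof.
move=> sumE Pw w0.
have wE : l1norm w = \sum_n w n ord0.
  by apply: eq_bigr => n _; rewrite ger0_norm.
split.
  split=> // v Pv; rewrite wE -(sumE v Pv); apply: ler_sum => n _.
  exact: ler_norm.
move=> v [Pv /(_ w Pw)]; rewrite wE -(sumE v Pv) => vle n.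
have /eqP : \sum_n (`|v n ord0| - v n ord0) = 0.
  apply/eqP; rewrite sumrB subr_eq0 eq_le vle/=; apply: ler_sum => k _.
  exact: ler_norm.
rewrite psumr_eq0 => [/allP /(_ n (mem_index_enum _))|k _].
  by rewrite /= subr_eq0 => /eqP <-.
by rewrite subr_ge0 ler_norm.
Qed.

End WeightVectors.

(** * Convergence of the solutions of perturbed linear systems *)

Section Perturbation.
Variables (R : realType) (K : nat).
Implicit Types (G A : 'M[R]_K) (c y : 'cV[R]_K).

Lemma l1norm_mulmx A y :
  l1norm (A *m y) <= (\sum_i \sum_j `|A i j|) * l1norm y.
Proof.
rewrite /l1norm mulr_suml; apply: ler_sum => i _; rewrite mxE.
rewrite (le_trans (ler_norm_sum _ _ _))// mulr_suml; apply: ler_sum => j _.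
by rewrite normrM ler_wpM2l// (bigD1 j)//= lerDl sumr_ge0.
Qed.

(** From [y - c = G^-1 (G - A N) y] the error [s = l1norm (y - c)] satisfies
    [s <= t (s + l1norm c)] with [t] small, hence [s <= 2 t l1norm c]. *)
Lemma solution_cvg (A : nat -> 'M[R]_K) G c (e : R) : G \in unitmx -> 0 < e ->
  (forall i j, A N i j @[N --> \oo] --> G i j) ->
  \forall N \near \oo, forall y, A N *m y = G *m c -> l1norm (y - c) <= e.
Proof.
move=> GU e0 AG.
pose a M := \sum_i \sum_j `|(M : 'M[R]_K) i j|.
have a0 M : 0 <= a M by apply: sumr_ge0 => i _; apply: sumr_ge0.
have n0 v : 0 <= l1norm (v : 'cV[R]_K) by exact: sumr_ge0.
pose g := a (invmx G); pose C := l1norm c.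
(* t <= 1/2 absorbs the term t * s, and the other bound gives 2 t C <= e;
   eta is the entrywise distance from A N to G that ensures this t. *)
pose t := Num.min (2^-1) (e / (2 * (C + 1))).
have C1 : 0 < C + 1 by rewrite ltr_wpDl// n0.
have t0 : 0 < t by rewrite lt_min invr_gt0 ltr0n divr_gt0// mulr_gt0.
pose eta := t / ((g + 1) * (K%:R * K%:R + 1)).
have g1 : 0 < g + 1 by rewrite ltr_wpDl// a0.
have K1 : 0 < K%:R * K%:R + 1 :> R by rewrite ltr_wpDl// mulr_ge0.
have eta0 : 0 < eta by rewrite divr_gt0// mulr_gt0.
have : \forall N \near \oo, forall i j, `|G i j - A N i j| <= eta.
  apply: filter_forall => i; apply: filter_forall => j.
  have /cvgrPdist_le := AG i j; exact.
apply: filterS => N GA y Ay.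
have aGA : a (G - A N) <= K%:R * K%:R * eta.
  rewrite (_ : _ * eta = \sum_(i < K) \sum_(j < K) eta).
    by apply: ler_sum => i _; apply: ler_sum => j _; rewrite !mxE.
  by rewrite !sumr_const card_ord -mulrA !mulr_natl.
have zE : y - c = invmx G *m ((G - A N) *m y).
  by rewrite mulmxBl Ay -mulmxBr mulmxA mulVmx// mul1mx.
have z_le : l1norm (y - c) <= t * l1norm y.
  rewrite {1}zE (le_trans (l1norm_mulmx _ _))//.
  apply: (@le_trans _ _ (g * ((K%:R * K%:R * eta) * l1norm y))).
    rewrite ler_wpM2l ?a0// (le_trans (l1norm_mulmx _ _))// ler_wpM2r//.
  rewrite mulrA ler_wpM2r//.
  have -> : t = (g + 1) * ((K%:R * K%:R + 1) * eta).
    by rewrite /eta; field; rewrite !gt_eqF.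
  apply: ler_pM; rewrite ?lerDl ?a0//.
    by rewrite mulr_ge0 ?(ltW eta0)// mulr_ge0.
  by rewrite ler_wpM2r ?lerDl// ltW.
have y_le : l1norm y <= l1norm (y - c) + C.
  rewrite /C /l1norm -big_split; apply: ler_sum => i _ /=.
  by rewrite -{1}(subrK c y) mxE ler_normD.
have t2 : t <= 2^-1 by rewrite ge_min lexx.
have te : t * (2 * (C + 1)) <= e.
  by rewrite -ler_pdivlMr ?mulr_gt0// ge_min lexx orbT.
have s0 := n0 (y - c); have C0 : 0 <= C := n0 c.
nra.
Qed.

End Perturbation.

(** * Gram matrices of a polynomial basis *)

Section GramMatrices.
Variables (R : realType) (q d K : nat) (p : 'I_K -> mpoly q R).
Variables (Omega : set 'rV[R]_q) (omega : 'rV[R]_q -> R).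
Hypothesis bounded_Omega : bounded_set Omega.
Hypothesis measurable_Omega : lebesgue_outer.-cara.-measurable Omega.
Hypothesis omega_ge0 : forall y, Omega y -> 0 <= omega y.
Hypothesis integrable_omega : lebesgue_Rn.-integrable Omega (EFin \o omega).
Hypothesis basis_p : basis_of_polys d p.

Lemma peval_sum (c : 'I_K -> R) y :
  peval (\sum_k c k *: p k) y = \sum_k c k * peval (p k) y.
Proof.
rewrite /peval raddf_sum; apply: eq_bigr => k _; exact: mevalZ.
Qed.

Lemma polys_sum (c : 'I_K -> R) : polys d (\sum_k c k *: p k).
Proof.
have [pd _ _] := basis_p; rewrite /polys /=.
apply: leq_trans (msize_sum _ _ _) _.
apply/bigmax_leqP => k _; exact: leq_trans (mmeasureZ_le _ _ _) (pd k).
Qed.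

Definition gram_mx : 'M[R]_K :=
  \matrix_(i, j) weighted_integral Omega omega
    (fun y => peval (p i) y * peval (p j) y).

Lemma moments_gram (c : 'cV[R]_K) :
  (forall y, \sum_k c k ord0 * peval (p k) y = 1) ->
  moments Omega omega p = gram_mx *m c.
Proof.
move=> c1; apply/colP => i; rewrite !mxE.
under eq_bigr do rewrite mxE mulrC.
rewrite -weighted_integral_sum//; last first.
  by move=> k; apply: PolyMul; exact: polyfun_peval.
congr weighted_integral; apply/funext => y.
under eq_bigr do rewrite mulrCA.
by rewrite -mulr_sumr c1 mulr1.
Qed.

Lemma gram_form (v : 'rV[R]_K) :
  (v *m gram_mx *m v^T) ord0 ord0 =
  weighted_integral Omega omega (fun y =>
    (\sum_k v ord0 k * peval (p k) y) * (\sum_k v ord0 k * peval (p k) y)).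
Proof.
under [in RHS]eq_fun do rewrite mulr_suml.
have vP : polyfun (fun y => \sum_k v ord0 k * peval (p k) y).
  by under eq_fun do rewrite -peval_sum; exact: polyfun_peval.
under [in RHS]eq_fun do under eq_bigr do rewrite -mulrA.
rewrite weighted_integral_sum//; last first.
  by move=> i; apply: PolyMul => //; exact: polyfun_peval.
rewrite -mulmxA mxE; apply: eq_bigr => i _; congr (_ * _); rewrite mxE.
under [in RHS]eq_fun do rewrite mulr_sumr.
under [in RHS]eq_fun do under eq_bigr do rewrite mulrCA.
rewrite weighted_integral_sum//; last first.
  by move=> j; apply: PolyMul; exact: polyfun_peval.
by apply: eq_bigr => j _; rewrite !mxE mulrC.
Qed.

Lemma coordinates_eq0 (Y : set 'rV[R]_q) (v : 'rV[R]_K) : unisolvent d Y ->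
  (forall y, Y y -> \sum_k v ord0 k * peval (p k) y = 0) -> v = 0.
Proof.
move=> uni v0; have [_ indep _] := basis_p; apply/rowP => k; rewrite mxE.
apply: (indep (fun k => v ord0 k)); apply: uni => [|y Yy].
  exact: polys_sum.
by rewrite peval_sum v0.
Qed.

(** A kernel vector is a polynomial whose square has weighted integral 0; if it
    were nonzero, all the moments would be 0. *)
Lemma gram_unit : unisolvent d [set: 'rV[R]_q] ->
  moments Omega omega p != 0 -> gram_mx \in unitmx.
Proof.
move=> uni m0; rewrite -row_free_unit; apply: inj_row_free => v vG.
apply: contrapT => vn0; move/negP: m0; apply; apply/eqP/colP => k; rewrite !mxE.
apply: (@weighted_integral_degenerate _ _ _ _ bounded_Omega measurable_Omega
  omega_ge0 integrable_omega (peval (\sum_k v ord0 k *: p k))).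
- exact: polyfun_peval.
- exact: polyfun_peval.
- apply: contrapT => nz; apply: vn0; apply: (coordinates_eq0 uni) => y _.
  rewrite -peval_sum; apply/eqP/negPn/negP => nzy; apply: nz.
  by exists y.
- under eq_fun do rewrite !peval_sum.
  by rewrite -gram_form vG mul0mx mxE.
Qed.

Section Nodes.
Variables (N : nat) (X : 'I_N -> 'rV[R]_q).
Let P := eval_mx X p.
Let r := ls_scaling Omega omega X.

Lemma exact_weights_exactness w :
  P *m w = moments Omega omega p -> has_exactness Omega omega X d w.
Proof.
move=> Pw f fd; have [_ _ /(_ f fd)[c ->]] := basis_p.
have -> := funext (peval_sum c).
rewrite weighted_integral_sum//; last by move=> k; exact: polyfun_peval.
rewrite /cubature; under eq_bigr do rewrite mulr_sumr.
rewrite exchange_big /=; apply: eq_bigr => k _.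
have /colP /(_ k) := Pw; rewrite !mxE => <-; rewrite mulr_sumr.
by apply: eq_bigr => n _; rewrite mxE mulrCA [X in _ * X]mulrC.
Qed.

Lemma discrete_gramE i j : (P *m diag_mx r *m P^T) i j =
  volume Omega / N%:R *
    \sum_n peval (p i) (X n) * peval (p j) (X n) * omega (X n).
Proof.
rewrite mul_mx_diag mxE mulr_sumr; apply: eq_bigr => n _.
by rewrite !mxE; ring.
Qed.

(** The discrete Gram form is a sum of squares with weights [r]; a kernel vector
    vanishes at all nodes of positive weight. *)
Lemma discrete_gram_unit (Y : set 'rV[R]_q) : unisolvent d Y ->
  (forall n, 0 <= r ord0 n) ->
  (forall y, Y y -> exists n, X n = y /\ 0 < r ord0 n) ->
  P *m diag_mx r *m P^T \in unitmx.
Proof.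
move=> uni r0 YX; rewrite -row_free_unit; apply: inj_row_free => v vG.
apply: (coordinates_eq0 uni) => y /YX[n [<- rn]].
have : \sum_n r ord0 n * ((v *m P) ord0 n) ^+ 2 = 0.
  have : (v *m (P *m diag_mx r *m P^T) *m v^T) ord0 ord0 = 0.
    by rewrite vG mul0mx mxE.
  rewrite -!mulmxA -trmx_mul mul_diag_mx mulmxA mxE => e; rewrite -[RHS]e.
  by apply: eq_bigr => k _; rewrite !mxE; ring.
move/eqP; rewrite psumr_eq0 => [/allP /(_ n (mem_index_enum _))|k _]; last first.
  by rewrite mulr_ge0 ?sqr_ge0.
rewrite /= mulf_eq0 gt_eqF//= sqrf_eq0 => /eqP; rewrite mxE => e; rewrite -[RHS]e.
by apply: eq_bigr => k _; rewrite mxE.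
Qed.

(** The weight at the node [X n] is [r_n q(X n)] where [q] has the coordinates
    [y = A^-1 m]; the last hypothesis says that [y] is so close to the
    coordinates [c] of 1 that [|q - 1| <= 1] at the nodes. *)
Lemma ls_formula_nonneg (c : 'cV[R]_K) (B : R) :
  (forall n, 0 <= r ord0 n) ->
  (forall y, \sum_k c k ord0 * peval (p k) y = 1) ->
  (forall k n, `|peval (p k) (X n)| <= B) ->
  l1norm (invmx (P *m diag_mx r *m P^T) *m moments Omega omega p - c) * B <= 1 ->
  nonnegative_weights (ls_formula P r (moments Omega omega p)).
Proof.
move=> r0 c1 pB; set y := invmx _ *m _ => yB n.
have -> : ls_formula P r (moments Omega omega p) = diag_mx r *m (P^T *m y).
  by rewrite /ls_formula /y !mulmxA.
rewrite mul_diag_mx mxE mulr_ge0// mxE.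
move: y yB => y yB; under eq_bigr do rewrite !mxE.
have -> : \sum_k peval (p k) (X n) * y k ord0 =
    1 + \sum_k (y - c) k ord0 * peval (p k) (X n).
  rewrite -(c1 (X n)) -big_split; apply: eq_bigr => k _ /=.
  by rewrite !mxE; ring.
have : `|\sum_k (y - c) k ord0 * peval (p k) (X n)| <= 1.
  apply: le_trans yB; rewrite (le_trans (ler_norm_sum _ _ _))// mulr_suml.
  by apply: ler_sum => k _; rewrite normrM ler_wpM2l.
by rewrite ler_norml => /andP[+ _]; rewrite lerNl -subr_ge0 opprK addrC.
Qed.

End Nodes.

End GramMatrices.

(** * Nonnegativity of the cubature formulas *)

Theorem corollary4p2 (R : realType) (q d : nat)
    (Omega : set 'rV[R]_q) (omega : 'rV[R]_q -> R)
    (x : nat -> 'rV[R]_q) (N0 : nat)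
    (p : 'I_'C(d + q, q) -> mpoly.mpoly q R) :
  bounded_set Omega ->
  lebesgue_outer.-cara.-measurable Omega ->
  0 < volume Omega ->
  (forall y, Omega y -> 0 <= omega y) ->
  lebesgue_Rn.-integrable Omega (EFin \o omega) ->
  basis_of_polys d p ->
  injective x ->
  (forall n, Omega (x n)) ->
  unisolvent d [set x n | n in `I_N0] ->
  (forall n, (n < N0)%N -> 0 < omega (x n)) ->
  (forall u v : mpoly.mpoly q R, polys d u -> polys d v ->
     volume Omega / N%:R *
       \sum_(n < N) peval u (x n) * peval v (x n) * omega (x n) @[N --> \oo]
     --> weighted_integral Omega omega (fun y => peval u y * peval v y)) ->
  exists N1 : nat, forall N : nat, (N1 <= N)%N ->
    let X := fun n : 'I_N => x n in
    let P := eval_mx X p in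
    let m := moments Omega omega p in
    let r := ls_scaling Omega omega X in
    (exists w : 'cV[R]_N,
       [/\ is_ls_weights P r m w,
           forall v, is_ls_weights P r m v -> v = w,
           has_exactness Omega omega X d w
         & nonnegative_weights w]) /\
    ((exists w : 'cV[R]_N, is_l1_weights P m w) /\
     forall w : 'cV[R]_N, is_l1_weights P m w ->
       has_exactness Omega omega X d w /\ nonnegative_weights w).
Proof.
move=> bO mO vol0 om0 omI basis _ xO uni ompos hlim.
have uniT : unisolvent d [set: 'rV[R]_q].
  by move=> f fd f0; apply: uni => // y _; exact: f0.
have [c cE] : exists c : 'cV[R]_('C(d + q, q)),
    forall y, \sum_k c k ord0 * peval (p k) y = 1.
  have [_ _ /(_ 1)[]] := basis; first by rewrite /polys /= msize1.
  move=> c cE; exists (\col_k c k) => y.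
  under eq_bigr do rewrite mxE.
  by rewrite -peval_sum -cE /peval meval1.
have r_ge0 N (n : 'I_N) : 0 <= ls_scaling Omega omega (fun n : 'I_N => x n) ord0 n.
  by rewrite mxE divr_ge0// mulr_ge0 ?om0// ltW.
have gram N : (N0 <= N)%N -> (0 < N)%N ->
    let P := eval_mx (fun n : 'I_N => x n) p in
    P *m diag_mx (ls_scaling Omega omega (fun n : 'I_N => x n)) *m P^T \in unitmx.
  move=> N0N N_gt0; apply: (discrete_gram_unit basis uni) => // y [n nN0 <-].
  exists (Ordinal (leq_trans nN0 N0N)); split => //.
  by rewrite mxE divr_gt0 ?ltr0n// mulr_gt0// ompos.
have [N2 ls_nonneg] : exists N2, forall N, (N2 <= N)%N -> (N0 <= N)%N -> (0 < N)%N ->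
    nonnegative_weights (ls_formula (eval_mx (fun n : 'I_N => x n) p)
      (ls_scaling Omega omega (fun n : 'I_N => x n)) (moments Omega omega p)).
  have [m0|m_neq0] := eqVneq (moments Omega omega p) 0.
    by exists 0%N => N _ _ _ n; rewrite m0 /ls_formula mulmx0 mxE.
  have [B pB] : exists B, forall k n, `|peval (p k) (x n)| <= B.
    have /choice[b bP] k := polyfun_bounded_domain bO (polyfun_peval (p k)).
    exists (\sum_k `|b k|) => k n; apply: le_trans (bP k _ (xO n)) _.
    by rewrite (le_trans (ler_norm _))// (bigD1 k)//= lerDl sumr_ge0.
  have B1 : 0 < `|B| + 1 by rewrite ltr_wpDl.
  have e0 : 0 < (`|B| + 1)^-1 by rewrite invr_gt0.
  have GU := gram_unit bO mO om0 omI basis uniT m_neq0.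
  have gram_cvg i j : (eval_mx (fun n : 'I_N => x n) p
      *m diag_mx (ls_scaling Omega omega (fun n : 'I_N => x n))
      *m (eval_mx (fun n : 'I_N => x n) p)^T) i j @[N --> \oo]
      --> gram_mx p Omega omega i j.
    rewrite [X in _ --> X]mxE; under eq_fun do rewrite discrete_gramE.
    by have [pd _ _] := basis; exact: hlim.
  have [N2 _ N2P] := solution_cvg c GU e0 gram_cvg.
  exists N2 => N N2N N0N N_gt0.
  apply: (@ls_formula_nonneg _ _ _ _ _ _ _ _ c `|B|) => //.
    by move=> k n; exact: le_trans (pB k n) (ler_norm _).
  apply: (@le_trans _ _ ((`|B| + 1)^-1 * `|B|)).
    rewrite ler_wpM2r//; apply: (N2P N N2N).
    by rewrite mulmxA (mulmxV (gram N N0N N_gt0)) mul1mx; exact: moments_gram.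
  by rewrite mulrC ler_pdivrMr// mul1r lerDl.
pose N1 := maxn N2 (maxn N0 1); exists N1 => N.
rewrite !geq_max => /and3P[N2N N0N N_gt0] X P m r.
have AU : P *m diag_mx r *m P^T \in unitmx by exact: gram.
have [ls_is ls_uniq] := ls_weights_formula m AU.
have ls0 : nonnegative_weights (ls_formula P r m) by exact: ls_nonneg.
have exact w : P *m w = m -> has_exactness Omega omega X d w.
  by move=> Pw; apply: (exact_weights_exactness bO mO omI basis).
have Pls : P *m ls_formula P r m = m := ls_formula_exact m AU.
split; first by exists (ls_formula P r m); split => //; exact: exact.
have sumE w : P *m w = m -> \sum_n w n ord0 = weighted_integral Omega omega (peval 1).
  move=> /exact <-; last by rewrite /polys /= msize1.
  by apply: eq_bigr => n _; rewrite /peval meval1 mulr1.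
have [l1_is l1_nonneg] : is_l1_weights P m (ls_formula P r m) /\
    forall v, is_l1_weights P m v -> nonnegative_weights v.
  by apply: l1_weights_nonneg => // v Pv; rewrite !sumE.
split; first by exists (ls_formula P r m).
by move=> w wl1; split; [exact: exact wl1.1|exact: l1_nonneg].
Qed.
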